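(* Let $n\ge 2$, let $|\varphi\rangle$ be an $n\times n$ state and let $|\psi\rangle$ be a state in $S^{o}(|\varphi\rangle)$. Let $|\Phi^{+}\rangle=\sum_{i=1}^k\frac{1}{\sqrt{k}}|i\rangle|i\rangle$ be a $k\times k$ maximally entangled state. Then there exists a positive number $\delta$ such that for any $k\times k$ state $|\chi\rangle$ satisfying $\||\chi\rangle-|\Phi^{+}\rangle\|<\delta$, the transformation of $|\psi\rangle\otimes|\chi\rangle$ to $|\varphi\rangle\otimes|\Phi^{+}\rangle$ can be realized with certainty by LOCC, i.e., $|\psi\rangle\otimes|\chi\rangle\rightarrow|\varphi\rangle\otimes|\Phi^{+}\rangle$.
   Context: An $n\times n$ state $|\psi\rangle$ is a bipartite pure state in $\mathbb{C}^n\otimes\mathbb{C}^n$ with Schmidt decomposition $\sum_i\sqrt{\alpha_i}|i_A\rangle|i_B\rangle$; $\psi=(\alpha_1,\dots,\alpha_n)$ is its Schmidt coefficient (probability) vector, $\alpha_1\ge\dots\ge\alpha_n\ge0$. The vector of $|\psi\rangle\otimes|\chi\rangle$ is the Kronecker product $\psi\otimes\chi$ (up to order). With $e_l(x)$ the sum of the $l$ largest components of $x$ and $x,y$ of dimension $N$: $x\prec y$ means $e_l(x)\le e_l(y)$ for $1\le l<N$ and $e_N(x)=e_N(y)$; $x\lhd y$ means $e_l(x)<e_l(y)$ for $1\le l<N$ and $e_N(x)=e_N(y)$. $S^{o}(|\varphi\rangle)$ is the set of $n\times n$ states $|\psi\rangle$ with $\psi\lhd\varphi$. $|\psi\rangle\to|\varphi\rangle$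 means deterministic transformability by LOCC, which by Nielsen's theorem is equivalent to $\psi\prec\varphi$. The distance $\||\psi\rangle-|\varphi\rangle\|$ is defined as the Euclidean distance between the ordered Schmidt coefficient vectors: $\sqrt{\sum_i(\psi^{\downarrow}_i-\varphi^{\downarrow}_i)^2}$, where $x^{\downarrow}$ is the non-increasing rearrangement. *)

(* Defs.v *)
From mathcomp Require Import all_boot all_order all_algebra.
From mathcomp Require Import boolp classical_sets reals.
From mathcomp Require Export complex mxtens.

Set Implicit Arguments.
Unset Strict Implicit.
Unset Printing Implicit Defensive.

Import Order.TTheory GRing.Theory Num.Theory.

Local Open Scope ring_scope.
Local Open Scope complex_scope.

(* A vector \sum_(i, j) psi i j |i>_A |j>_B of C^m (x) C^n is represented by its
   matrix of amplitudes psi : 'M[R[i]]_(m, n).  With this encoding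
   - (X (x) Y) |psi> has matrix X *m psi *m Y^T (plain transpose on B's side);
   - |psi> (x) |chi>, with A holding the first and B the second halves of both
     factors, has matrix psi *t chi (Kronecker product of matrices). *)

Definition adjointmx (R : realType) (m n : nat) (A : 'M[R[i]]_(m, n)) :
  'M[R[i]]_(n, m) := map_mx (@Num.conj R[i]) A^T.

Definition is_state (R : realType) (m n : nat) (psi : 'M[R[i]]_(m, n)) : Prop :=
  \sum_(i < m) \sum_(j < n) `|psi i j| ^+ 2 = 1.

(* psi = \sum_i sqrt(a_i) |u_i>_A |v_i>_B for orthonormal bases (u_i), (v_i)
   (the columns of U and V) and a_1 >= ... >= a_n >= 0. *)
Definition is_schmidt (R : realType) (n : nat) (psi : 'M[R[i]]_n)
    (a : 'rV[R]_n) : Prop :=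
  [/\ forall i, 0 <= a 0 i,
      forall i j : 'I_n, (i <= j)%N -> a 0 j <= a 0 i &
      exists U V : 'M[R[i]]_n,
        [/\ adjointmx U *m U = 1%:M, adjointmx V *m V = 1%:M &
            psi = \sum_(i < n)
                    (Num.sqrt (a 0 i))%:C *: (col i U *m (col i V)^T)]].

(* Such a vector always exists and is unique, so the default 0 is never used. *)
Definition schmidt_coef (R : realType) (n : nat) (psi : 'M[R[i]]_n) :
  'rV[R]_n := xget 0 [set a | is_schmidt psi a]%classic.

Definition rearr (R : realType) (N : nat) (x : 'rV[R]_N) : 'rV[R]_N :=
  \row_(i < N) nth 0 (sort >=%R [seq x 0 j | j <- enum 'I_N]) i.

Definition esum (R : realType) (N : nat) (l : nat) (x : 'rV[R]_N) : R :=
  \sum_(i < N | (i < l)%N) rearr x 0 i.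

Definition strict_majorized (R : realType) (N : nat) (x y : 'rV[R]_N) : Prop :=
  (forall l : nat, (1 <= l < N)%N -> esum l x < esum l y) /\
  esum N x = esum N y.

Definition So (R : realType) (n : nat) (phi : 'M[R[i]]_n) : set 'M[R[i]]_n :=
  [set psi | is_state psi /\
             strict_majorized (schmidt_coef psi) (schmidt_coef phi)]%classic.

Definition state_dist (R : realType) (n : nat) (psi phi : 'M[R[i]]_n) : R :=
  Num.sqrt (\sum_(i < n) (rearr (schmidt_coef psi) 0 i -
                          rearr (schmidt_coef phi) 0 i) ^+ 2).

Definition max_entangled (R : realType) (k : nat) : 'M[R[i]]_k :=
  \sum_(i < k) (1 / Num.sqrt k%:R)%:C *: delta_mx i i.

Definition is_measurement (R : realType) (m p r : nat)
    (K : 'I_r -> 'M[R[i]]_(p, m)) : Prop :=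
  \sum_(t < r) adjointmx (K t) *m K t = 1%:M.

(* Finite-round LOCC protocols taking psi to phi with certainty: in each round
   one party performs a generalized measurement (Kraus operators K t, possibly
   changing the local dimension, hence including local ancillas and unitaries)
   and the announced outcome t determines the rest of the protocol.
   Post-measurement vectors are not renormalized; a branch ends successfully
   when its vector is a multiple of phi (global phases are immaterial, and the
   multiple is 0 exactly for branches of probability 0). *)
Inductive locc (R : realType) (p q : nat) (phi : 'M[R[i]]_(p, q)) :
    forall m n : nat, 'M[R[i]]_(m, n) -> Prop :=
| locc_stop (c : R[i]) : locc phi (c *: phi)
| locc_Alice (m n m' r : nat) (K : 'I_r -> 'M[R[i]]_(m', m))
    (psi : 'M[R[i]]_(m, n)) :
    is_measurement K -> (forall t, locc phi (K t *m psi)) -> locc phi psi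
| locc_Bob (m n n' r : nat) (K : 'I_r -> 'M[R[i]]_(n', n))
    (psi : 'M[R[i]]_(m, n)) :
    is_measurement K -> (forall t, locc phi (psi *m (K t)^T)) -> locc phi psi.

Definition locc_transformable (R : realType) (m n p q : nat)
    (psi : 'M[R[i]]_(m, n)) (phi : 'M[R[i]]_(p, q)) : Prop := locc phi psi.

(* Main.v *)
(* Let a and b be the Schmidt vectors of psi and phi, c that of chi, and u the
   uniform vector of length k.  The sum of the l largest entries of a (x) u is a
   sum over m < k of sums of initial segments of a, one for each residue m
   modulo k, and for 0 < l < n k at least one of these segments is neither empty
   nor full (this is where n >= 2 enters); so the strict majorization of a by b
   gives the strict majorization of a (x) u by b (x) u.  There are finitely many
   strict inequalities, hence they survive replacing u by a nearby c on the left,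
   while the total sums remain equal to 1.  Then, as in Nielsen's theorem, the
   majorized vector is reached from the other by transpositions mixed with the
   identity, each of which is realized by one measurement of Alice followed by a
   permutation on Bob's side; local unitaries from the singular value
   decomposition reduce arbitrary states to diagonal ones. *)

Require Import Defs.
From mathcomp Require Import all_boot all_order all_algebra perm.
From mathcomp Require Import classical_sets reals ring lra zify.

Set Implicit Arguments.
Unset Strict Implicit.
Unset Printing Implicit Defensive.

Import Order.TTheory GRing.Theory Num.Theory.

Local Open Scope ring_scope.
Local Open Scope complex_scope.

(** * Sorting, adjoints and the singular value decomposition *)

Lemma sorting_perm (R : realDomainType) N (x : 'I_N -> R) :
  exists s : 'S_N, forall i j : 'I_N, (i <= j)%N -> x (s j) <= x (s i).
Proof.
pose le := fun i j : 'I_N => x j <= x i.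
have le_total : total le by move=> i j; exact: le_total.
have le_trans : transitive le by move=> i j k /[swap]; exact: le_trans.
have /tuple_permP[s es] : perm_eq (sort le (enum 'I_N)) (ord_tuple N).
  by rewrite perm_sort val_ord_tuple.
exists s => i j; rewrite leq_eqVlt => /predU1P[/val_inj-> //|ij].
have nthE (k : 'I_N) : nth i (sort le (enum 'I_N)) k = s k.
  by rewrite es (nth_map i) ?size_enum_ord // nth_ord_enum tnth_ord_tuple.
rewrite -!nthE; set t := sort le _; rewrite -/(le (nth i t i) (nth i t j)).
apply: (sorted_ltn_nth le_trans i (sort_sorted le_total (enum 'I_N)) i j) ij;
  by rewrite inE size_sort size_enum_ord.
Qed.

Lemma adjointmxM (R : realType) m n p (A : 'M[R[i]]_(m, n)) (B : 'M[R[i]]_(n, p)) :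
  adjointmx (A *m B) = adjointmx B *m adjointmx A.
Proof. by rewrite /adjointmx trmx_mul map_mxM. Qed.

Lemma adjointmxZ (R : realType) m n c (A : 'M[R[i]]_(m, n)) :
  adjointmx (c *: A) = Num.conj c *: adjointmx A.
Proof. by apply/matrixP => i j; rewrite !mxE rmorphM. Qed.

Lemma adjointmxK (R : realType) m n (A : 'M[R[i]]_(m, n)) :
  adjointmx (adjointmx A) = A.
Proof. exact: trmxCK. Qed.

Lemma mulmx_adj_diag (R : realType) n (W : 'M[R[i]]_n) i :
  (W *m adjointmx W) i i = \sum_j `|W i j| ^+ 2.
Proof. by rewrite mxE; apply: eq_bigr => j _; rewrite !mxE normCK. Qed.

Lemma conjCr (R : realType) (r : R) : Num.conj (r%:C : R[i]) = r%:C.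
Proof. exact: conjc_real. Qed.

(* Gram-Schmidt makes W times the adjoint of a unitary lower triangular with nonnegative
   diagonal; orthogonality of the rows of W then kills the entries below the
   diagonal, the null rows coming last. *)
Lemma orthogonal_rows_unitary (R : realType) n (W : 'M[R[i]]_n) (d : 'rV[R]_n) :
  (forall i j : 'I_n, (i <= j)%N -> d 0 j <= d 0 i) ->
  W *m adjointmx W = diag_mx (map_mx (real_complex R) d) ->
  exists2 S : 'M[R[i]]_n, S *m adjointmx S = 1%:M &
    W = diag_mx (map_mx (fun r => (Num.sqrt r)%:C) d) *m S.
Proof.
move=> dsorted WW; pose S := schmidt W.
have SU : S \is unitarymx by exact: schmidt_unitarymx.
have SS : S *m adjointmx S = 1%:M by exact/unitarymxP.
have SS' : adjointmx S *m S = 1%:M by exact: mulmx1C.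
exists S => //; pose T := W *m adjointmx S.
have WE : W = T *m S by rewrite -mulmxA SS' mulmx1.
have TT : T *m adjointmx T = diag_mx (map_mx (real_complex R) d).
  by rewrite adjointmxM adjointmxK mulmxA -WE.
have TTE i j : \sum_k T i k * Num.conj (T j k) = (d 0 i)%:C *+ (i == j).
  have /matrixP/(_ i j) := TT; rewrite !mxE => <-.
  by apply: eq_bigr => k _; rewrite !mxE.
have Tdot i j : T i j = dotmx (row i W) (row j S).
  by rewrite dotmxE !mxE; apply: eq_bigr => k _; rewrite !mxE.
(* Row i of [W] lies in the span of the rows of [S] of index at most i, all orthogonal to row j when
   i < j. *)
have T_low (i j : 'I_n) : (i < j)%N -> T i j = 0.
  move=> ij; rewrite Tdot dotmxE.
  suff /sub_kermxP -> : (row i W <= kermx (map_mx Num.conj (row j S)^T))%MS.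
    by rewrite mxE.
  apply: (submx_trans (row_schmidt_sub _ _)).
  apply/sumsmx_subP => k ki; rewrite genmxE; apply/sub_kermxP.
  apply/matrixP => a b; rewrite !ord1 -dotmxE (row_unitarymxP SU) mxE.
  by case: eqP => // kj; move: ki; rewrite kj leqNgt ij.
have Tnn2 i : \sum_k `|T i k| ^+ 2 = (d 0 i)%:C.
  by rewrite -mulmx_adj_diag TT !mxE eqxx.
have Tpos i : 0 <= T i i by rewrite Tdot form1_row_schmidt.
have d0 i : 0 <= d 0 i.
  by rewrite -ler0c -Tnn2 sumr_ge0 // => k _; rewrite exprn_ge0.
(* Strong induction on the row: once row j < i is diagonal, orthogonality of rows i and j reads T i
   j * sqrt(d_j) = 0, and d_j = 0 forces d_i = 0, so that row i vanishes. *)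
have Tdiag m (i : 'I_n) : (i < m)%N -> forall j, T i j = (Num.sqrt (d 0 i))%:C *+ (i == j).
  elim: m i => // m IH i; rewrite ltnS => im.
  have Toff j : j != i -> T i j = 0.
    case: (ltngtP i j) => [/T_low -> //|ji _|/val_inj->]; last by rewrite eqxx.
    have Tj := IH j (leq_trans ji im).
    have := TTE i j; rewrite (bigD1 j) //= big1 ?addr0; last first.
      by move=> k kj; rewrite Tj eq_sym (negbTE kj) mulr0n rmorph0 mulr0.
    rewrite Tj eqxx mulr1n conjCr.
    have /negbTE-> : i != j by rewrite -val_eqE neq_ltn ji orbT.
    rewrite mulr0n => /eqP; rewrite mulf_eq0 => /orP[/eqP //|].
    rewrite eq_complex /= eqxx andbT sqrtr_eq0 => dj0.
    have di0 : d 0 i = 0 by apply/le_anti; rewrite d0 (le_trans (dsorted _ _ (ltnW ji))).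
    have /eqP := Tnn2 i; rewrite di0 psumr_eq0; last by move=> k _; rewrite exprn_ge0.
    by move/allP/(_ j); rewrite mem_index_enum => /(_ isT) /=; rewrite expf_eq0 normr_eq0 => /eqP.
  move=> j; case: eqP => [<-|/eqP ij]; last by rewrite Toff // eq_sym.
  have := Tnn2 i; rewrite (bigD1 i) //= big1 ?addr0; last first.
    by move=> k /Toff ->; rewrite normr0 expr0n.
  rewrite ger0_norm // mulr1n => Tii.
  apply/eqP; rewrite -(@eqrXn2 _ 2) ?ler0c ?sqrtr_ge0 //.
  by rewrite Tii -rmorphXn /= sqr_sqrtr.
rewrite {1}WE; congr (_ *m _); apply/matrixP => i j.
by rewrite (Tdiag n) // !mxE.
Qed.

(** Amplitude matrix of the diagonal vector with coefficients sqrt(a_i) on |i>|i>. *)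
Definition sqrt_mx (R : realType) n (a : 'rV[R]_n) : 'M[R[i]]_n :=
  diag_mx (map_mx (fun r => (Num.sqrt r)%:C) a).

Lemma schmidt_sumE (R : realType) n (a : 'rV[R]_n) (U V : 'M[R[i]]_n) :
  \sum_(i < n) (Num.sqrt (a 0 i))%:C *: (col i U *m (col i V)^T) =
  U *m sqrt_mx a *m V^T.
Proof.
apply/matrixP => i j; rewrite summxE !mxE; apply: eq_bigr => k _.
rewrite mul_mx_diag !mxE big_ord1 !mxE.
by rewrite mulrCA mulrA.
Qed.

(** A unitary [Q] diagonalizes M M^* with eigenvalues in nonincreasing order, so Q M has orthogonal
    rows whose squared norms are these eigenvalues; normalizing the rows gives the second
    unitary. *)
Lemma is_schmidt_exists (R : realType) n (M : 'M[R[i]]_n) :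
  exists a, is_schmidt M a.
Proof.
pose H := M *m adjointmx M.
have HH : adjointmx H = H by rewrite adjointmxM adjointmxK.
have /orthomx_spectralP : H \is normalmx by apply/normalmxP; rewrite -/(adjointmx H) HH.
set P := spectralmx H; set D := spectral_diag H.
have PU : P \is unitarymx by exact: spectral_unitarymx.
rewrite invmx_unitary // -/(adjointmx P) => HE.
have PP : P *m adjointmx P = 1%:M by exact/unitarymxP.
have [s sP] := sorting_perm (fun i => complex.Re (D 0 i)).
pose Q := row_perm s P; pose d := \row_i complex.Re (D 0 (s i)).
have QQ : Q *m adjointmx Q = 1%:M.
  apply/unitarymxP/row_unitarymxP => i j.
  have rQ k : row k Q = row (s k) P by apply/rowP => l; rewrite !mxE.
  by rewrite !rQ (row_unitarymxP PU) (inj_eq perm_inj).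
have QQ' := mulmx1C QQ.
pose W := Q *m M.
have HD : P *m H *m adjointmx P = diag_mx D.
  by rewrite HE !mulmxA PP mul1mx -mulmxA PP mulmx1.
(* The eigenvalues are real, being the squared norms of the rows of P M; sorting by real parts thus
   loses nothing. *)
have Dre i : D 0 i = (complex.Re (D 0 i))%:C.
  have <- : (diag_mx D) i i = D 0 i by rewrite mxE eqxx.
  rewrite -HD /H !mulmxA -mulmxA -adjointmxM mulmx_adj_diag.
  by rewrite RRe_real // rpred_sum // => k _; rewrite rpredX // normr_real.
have WW : W *m adjointmx W = diag_mx (map_mx (real_complex R) d).
  have -> : W *m adjointmx W = Q *m H *m adjointmx Q by rewrite adjointmxM /H /W !mulmxA.
  apply/matrixP => i j.
  have -> : (Q *m H *m adjointmx Q) i j = (P *m H *m adjointmx P) (s i) (s j).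
    rewrite !mxE; apply: eq_bigr => k _; rewrite !mxE; congr (_ * _).
    by apply: eq_bigr => l _; rewrite !mxE.
  by rewrite HD !mxE (inj_eq perm_inj) -Dre.
have dsorted (i j : 'I_n) : (i <= j)%N -> d 0 j <= d 0 i by rewrite !mxE => /sP.
have [S /mulmx1C SS' WS] := orthogonal_rows_unitary dsorted WW.
exists d; split=> //.
  move=> i; have : 0 <= (diag_mx (map_mx (real_complex R) d)) i i.
    by rewrite -WW mulmx_adj_diag sumr_ge0 // => k _; rewrite exprn_ge0.
  by rewrite [_ i i]mxE eqxx mulr1n mxE ler0c.
exists (adjointmx Q), S^T; split; first by rewrite adjointmxK.
  apply: mulmx1C; rewrite /adjointmx trmxK.
  rewrite -(trmx1 _ n) -SS' trmx_mul; congr (_ *m _).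
  by rewrite /adjointmx map_trmx trmxK.
by rewrite schmidt_sumE trmxK -mulmxA -[sqrt_mx d *m S]WS /W mulmxA QQ' mul1mx.
Qed.

(** * LOCC protocols and the sufficiency direction of Nielsen's theorem *)

Section Locc.
Variables (R : realType) (p q : nat) (phi : 'M[R[i]]_(p, q)).

(** Rounds are linear and stopping accepts any multiple of [phi], so a scalar passes through the
    whole protocol. This absorbs the factors left by unnormalized measurements. *)
Lemma locc_scale m n (c : R[i]) (psi : 'M[R[i]]_(m, n)) :
  locc phi psi -> locc phi (c *: psi).
Proof.
elim=> {m n psi} [d|m n m' r K psi KK _ IH|m n n' r K psi KK _ IH].
- by rewrite scalerA; exact: locc_stop.
- by apply: (locc_Alice KK) => t; rewrite -scalemxAr.
- by apply: (locc_Bob KK) => t; rewrite -scalemxAl.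
Qed.

Lemma locc_Alice_isometry m n m' (U : 'M[R[i]]_(m', m)) (psi : 'M[R[i]]_(m, n)) :
  adjointmx U *m U = 1%:M -> locc phi (U *m psi) -> locc phi psi.
Proof.
move=> UU Upsi; apply: (@locc_Alice _ _ _ _ _ _ m' 1 (fun=> U)) => //.
by rewrite /is_measurement big_ord1.
Qed.

Lemma locc_Bob_isometry m n n' (V : 'M[R[i]]_(n', n)) (psi : 'M[R[i]]_(m, n)) :
  adjointmx V *m V = 1%:M -> locc phi (psi *m V^T) -> locc phi psi.
Proof.
move=> VV Vpsi; apply: (@locc_Bob _ _ _ _ _ _ n' 1 (fun=> V)) => //.
by rewrite /is_measurement big_ord1.
Qed.

Lemma adj_perm_mxK n (s : 'S_n) :
  adjointmx (perm_mx s : 'M[R[i]]_n) *m perm_mx s = 1%:M.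
Proof.
by rewrite /adjointmx tr_perm_mx map_perm_mx -perm_mxM mulVg perm_mx1.
Qed.

(* Alice applies the Kraus operators sqrt(p_t) P_t^-1 diag(sqrt(y o s_t / x)),
   where the convention 0/0 = 1 keeps the measurement complete; Bob undoes the
   permutation. *)
Lemma locc_mix N r (w : 'I_r -> R) (s : 'I_r -> 'S_N) (x y : 'rV[R]_N) :
  (forall t, 0 <= w t) -> \sum_t w t = 1 -> (forall i, 0 <= y 0 i) ->
  (forall i, x 0 i = \sum_t w t * y 0 (s t i)) ->
  locc phi (sqrt_mx y) -> locc phi (sqrt_mx x).
Proof.
move=> w0 w1 y0 xE phiy.
have wy0 i t : 0 <= w t * y 0 (s t i) by rewrite mulr_ge0.
have x0 i : 0 <= x 0 i by rewrite xE sumr_ge0.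
pose h t i := if x 0 i == 0 then 1 else Num.sqrt (y 0 (s t i) / x 0 i).
pose K t : 'M[R[i]]_N := (Num.sqrt (w t))%:C *:
  (perm_mx (s t)^-1 *m diag_mx (\row_i (h t i)%:C)).
have hh i : \sum_t w t * h t i ^+ 2 = 1.
  rewrite /h; case: eqP => [_|/eqP xi].
    by under eq_bigr do rewrite expr1n mulr1.
  under eq_bigr do rewrite sqr_sqrtr ?divr_ge0 // mulrA.
  by rewrite -mulr_suml -xE divff.
(* If x_i = 0, the nonnegative terms w_t y_(s_t i) summing to x_i all vanish, so the default value 1
   of [h] does no harm. *)
have hx t i : Num.sqrt (w t) * (h t i * Num.sqrt (x 0 i)) =
              Num.sqrt (w t) * Num.sqrt (y 0 (s t i)).
  rewrite /h; case: eqP => [xi|/eqP xi]; last first.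
    by rewrite -(sqrtrM (x 0 i)) ?divr_ge0 // divfK.
  rewrite xi sqrtr0 !mulr0 -sqrtrM //.
  have /eqP := xi; rewrite xE psumr_eq0 // => /allP/(_ t).
  by rewrite mem_index_enum => /(_ isT)/eqP ->; rewrite sqrtr0.
have hadj t : adjointmx (diag_mx (\row_i (h t i)%:C)) = diag_mx (\row_i (h t i)%:C) :> 'M[R[i]]_N.
  rewrite /adjointmx tr_diag_mx map_diag_mx; congr diag_mx.
  by apply/rowP => i; rewrite !mxE; exact: conjCr.
apply: (@locc_Alice _ _ _ _ _ _ _ _ K).
  rewrite /is_measurement.
  have KK t : adjointmx (K t) *m K t = diag_mx (\row_i (w t * h t i ^+ 2)%:C).
    rewrite /K adjointmxZ conjCr.
    rewrite -scalemxAl -scalemxAr scalerA -rmorphM /= -expr2 sqr_sqrtr //.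
    rewrite adjointmxM mulmxA -(mulmxA _ (adjointmx _)) adj_perm_mxK mulmx1 hadj.
    apply/matrixP => i j; rewrite mulmx_diag !mxE mulrnAr -!rmorphM /=.
    by rewrite expr2.
  apply/matrixP => i j; rewrite summxE.
  under eq_bigr do rewrite KK !mxE.
  by rewrite sumrMnl -rmorph_sum /= hh mxE.
move=> t; apply: (@locc_Bob_isometry _ _ _ (perm_mx (s t)^-1)).
  exact: adj_perm_mxK.
suff -> : K t *m sqrt_mx x = (Num.sqrt (w t))%:C *: (sqrt_mx y *m perm_mx (s t)^-1).
  rewrite -scalemxAl -mulmxA tr_perm_mx -perm_mxM mulgV perm_mx1 mulmx1.
  exact: locc_scale.
rewrite -scalemxAl -mulmxA mulmx_diag; apply/matrixP => a i.
rewrite mul_mx_diag mul_diag_mx !mxE.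
case: eqP => [<-|_]; last by rewrite mul0r !mulr0.
by rewrite mul1r mulr1 -!rmorphM /= hx permKV.
Qed.

(* The induction is on the number of entries where x and y differ: moving mass
   from an entry with y > x to the first entry with y < x, a mixture of the
   identity and a transposition, makes one more entry agree.  Since x is sorted,
   y need not be. *)
Lemma locc_majorized N (x y : 'rV[R]_N) :
  (forall i, 0 <= y 0 i) ->
  (forall i j : 'I_N, (i <= j)%N -> x 0 j <= x 0 i) ->
  (forall l, \sum_(i < N | (i < l)%N) x 0 i <= \sum_(i < N | (i < l)%N) y 0 i) ->
  \sum_i x 0 i = \sum_i y 0 i ->
  locc phi (sqrt_mx y) -> locc phi (sqrt_mx x).
Proof.
move=> + xsorted; have [m] := ubnP #|[pred i | x 0 i != y 0 i]|.
elim: m y => // m IH y; rewrite ltnS => ym y0 xy xyN phiy.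
have [/existsP[k0 k0P]|yx] := boolP [exists k, y 0 k < x 0 k]; last first.
  have xley i : x 0 i <= y 0 i.
    by rewrite leNgt; apply/negP => lt; move: yx; rewrite negb_exists => /forallP/(_ i); rewrite lt.
  suff -> : x = y by [].
  apply/rowP => i; apply/eqP; rewrite eq_sym -subr_eq0.
  have : \sum_i (y 0 i - x 0 i) == 0 by rewrite sumrB xyN subrr.
  rewrite psumr_eq0; last by move=> *; rewrite subr_ge0.
  by move/allP/(_ i); rewrite mem_index_enum => /(_ isT).
case: (@arg_minnP _ k0 (fun i => y 0 i < x 0 i) (fun i => i : nat) k0P) => k kP kmin {k0 k0P}.
have below (i : 'I_N) : (i < k)%N -> x 0 i <= y 0 i.
  by move=> ik; rewrite leNgt; apply/negP => /kmin; rewrite leqNgt ik.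
(* The partial sums up to and including k satisfy x <= y although y_k < x_k, so some earlier entry
   has x < y. *)
have [j jk jP] : exists2 j : 'I_N, (j < k)%N & x 0 j < y 0 j.
  have := xy k.+1; rewrite (bigD1 k) //= [in X in _ <= X](bigD1 k) //=.
  move=> le; have [/existsP[j /andP[jk jP]]|] := boolP [exists j : 'I_N, (j < k)%N && (x 0 j < y 0 j)].
    by exists j.
  rewrite negb_exists => /forallP none; exfalso; move: le; apply/negP; rewrite -ltNge.
  apply: ltr_leD => //; apply: ler_sum => i /andP[ik ink].
  have ltik : (i < k)%N by rewrite ltn_neqAle -ltnS ik andbT.
  by have := none i; rewrite ltik /= -leNgt.
have jNk : (j == k) = false by rewrite -val_eqE ltn_eqF.
have xkj : x 0 k <= x 0 j by apply: xsorted; exact: ltnW.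
(* The largest amount that overshoots neither entry; it makes one of them agree with [x]. *)
pose d := Num.min (y 0 j - x 0 j) (x 0 k - y 0 k).
have d0 : 0 < d by rewrite lt_min !subr_gt0 jP.
have dj : d <= y 0 j - x 0 j by rewrite ge_min lexx.
have dk : d <= x 0 k - y 0 k by rewrite ge_min lexx orbT.
pose y' := \row_i (y 0 i - d *+ (i == j) + d *+ (i == k)).
have sumy' (P : pred 'I_N) : \sum_(i | P i) y' 0 i = \sum_(i | P i) y 0 i - d *+ P j + d *+ P k.
  have pick a : \sum_(i | P i) d *+ (i == a) = d *+ P a.
    rewrite big_mkcond (bigD1 a) //= eqxx big1 ?addr0; last first.
      by move=> i /negbTE ->; case: (P i).
    by case: (P a).
  rewrite (eq_bigr (fun i => y 0 i - d *+ (i == j) + d *+ (i == k))); last by move=> i _; rewrite mxE.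
  by rewrite big_split sumrB /= !pick.
have y'j : y' 0 j = y 0 j - d by rewrite mxE eqxx jNk addr0.
have y'k : y' 0 k = y 0 k + d by rewrite mxE eqxx eq_sym jNk subr0.
have y'i i : i != j -> i != k -> y' 0 i = y 0 i.
  by move=> /negbTE ij /negbTE ik; rewrite mxE ij ik subr0 addr0.
apply: (IH y').
- apply: leq_trans ym; apply: proper_card; apply/properP; split.
    apply/fintype.subsetP => i; rewrite !inE.
    have [-> _|ij] := eqVneq i j; first by rewrite lt_eqF.
    have [-> _|ik] := eqVneq i k; first by rewrite gt_eqF.
    by rewrite y'i.
  have [djk|djk] := leP (y 0 j - x 0 j) (x 0 k - y 0 k).
    exists j; rewrite !inE; first by rewrite lt_eqF.
    rewrite y'j /d min_l // negbK; apply/eqP; ring.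
  exists k; rewrite !inE; first by rewrite gt_eqF.
  rewrite y'k /d min_r ?ltW // negbK; apply/eqP; ring.
- move=> i; have [->|ij] := eqVneq i j; first by rewrite y'j; have := y0 k; lra.
  have [->|ik] := eqVneq i k; first by rewrite y'k addr_ge0 // ltW.
  by rewrite y'i.
(* Only the sums with j < l <= k decrease, by d. Before k all differences y - x are nonnegative, so
   the slack there is at least y_j - x_j >= d. *)
- move=> l; rewrite sumy'.
  have [lj|jl] := leqP l j.
    by rewrite [(k < l)%N]ltnNge (leq_trans lj (ltnW jk)) /= subr0 addr0.
  have [kl|lk] := ltnP k l; first by rewrite subrK.
  rewrite mulr1n mulr0n addr0 lerBrDl -lerBrDr -sumrB (le_trans dj) //.
  rewrite (bigD1 j) //= lerDl sumr_ge0 // => i /andP[il _].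
  by rewrite subr_ge0 below // (leq_trans il).
- by rewrite (sumy' xpredT) subrK.
(* Here sortedness of [x] enters: y_k < x_k <= x_j < y_j. The weight t of the transposition is
   chosen so that it moves exactly d. *)
have yjk : 0 < y 0 j - y 0 k by lra.
pose t := d / (y 0 j - y 0 k).
have tE : t * (y 0 j - y 0 k) = d by rewrite /t divfK // gt_eqF.
have t0 : 0 <= t by rewrite divr_ge0 // ltW.
have t1 : 0 <= 1 - t by rewrite subr_ge0 ler_pdivrMr // mul1r; lra.
apply: (@locc_mix _ 2 (fun b => if b == 0 then 1 - t else t)
          (fun b => if b == 0 then 1%g else tperm j k) _ y) => //.
- by move=> b; case: ifP.
- by rewrite big_ord_recl big_ord1 /= subrK.
move=> i; rewrite big_ord_recl big_ord1 /= perm1.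
have [->|ij] := eqVneq i j; first by rewrite tpermL y'j -tE; ring.
have [->|ik] := eqVneq i k; first by rewrite tpermR y'k -tE; ring.
by rewrite tpermD 1?eq_sym // y'i //; ring.
Qed.

End Locc.

(** * Partial sums of Kronecker products *)

Lemma mxtens_big (R : zmodType) n k (P : pred 'I_(n * k)) (F : 'I_(n * k) -> R) :
  \sum_(i | P i) F i =
  \sum_(j < n) \sum_(m < k | P (mxtens_index (j, m))) F (mxtens_index (j, m)).
Proof.
rewrite pair_big_dep /= (reindex (@mxtens_index n k)) /=; last first.
  by exists (@mxtens_unindex n k) => i _; rewrite (mxtens_indexK, mxtens_unindexK).
by apply: eq_big => [[]|[]].
Qed.

Lemma card_ltn_ord N l : #|[set i : 'I_N | (i < l)%N]| = minn l N.
Proof.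
rewrite cardsE -sum1_card; have [Nl|lN] := leqP N l.
  rewrite (eq_bigl xpredT) ?sum1_card ?card_ord // => i.
  by rewrite [LHS](leq_trans (ltn_ord i)).
by rewrite -[RHS](card_ord l) -sum1_card (big_ord_widen N (fun=> 1%N) (ltnW lN)).
Qed.

(** Subtract from [f] its value t at the last index of the initial segment. Both index sets have the
    same size, so the comparison is unchanged, and f - t is nonnegative on the segment and
    nonpositive beyond it. *)
Lemma sum_le_initial (R : realDomainType) N (f : 'I_N -> R) (A : {set 'I_N}) :
  (forall i j : 'I_N, (i <= j)%N -> f j <= f i) ->
  \sum_(i in A) f i <= \sum_(i < N | (i < #|A|)%N) f i.
Proof.
move=> fsorted; have [/eqP|A0] := posnP #|A|.
  by rewrite cards_eq0 => /eqP->; rewrite big_set0 big_pred0 // => i; rewrite cards0.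
have AN : (#|A| <= N)%N by rewrite -[X in (_ <= X)%N]card_ord max_card.
have pN : (#|A|.-1 < N)%N by rewrite prednK.
pose t := f (Ordinal pN).
have card_init : #|[set i : 'I_N | (i < #|A|)%N]| = #|A|.
  by rewrite card_ltn_ord; apply/minn_idPl.
have -> : \sum_(i < N | (i < #|A|)%N) f i = \sum_(i in [set i : 'I_N | (i < #|A|)%N]) f i.
  by apply: eq_bigl => i; rewrite inE.
rewrite -subr_ge0; have -> : \sum_(i in [set i : 'I_N | (i < #|A|)%N]) f i - \sum_(i in A) f i =
  \sum_(i in [set i : 'I_N | (i < #|A|)%N]) (f i - t) - \sum_(i in A) (f i - t).
  by rewrite !sumrB !sumr_const card_init; ring.
rewrite subr_ge0 [leLHS]big_mkcond [leRHS]big_mkcond; apply: ler_sum => i _.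
rewrite inE; case: ltnP => [iA|Ai]; case: ifP => // _.
  by rewrite subr_ge0 fsorted //= -ltnS prednK.
by rewrite subr_le0 fsorted //= (leq_trans (leq_pred _)).
Qed.

(* With i = j k + m, the condition i < l says that j < (l + (k - 1 - m)) / k. *)
Lemma initial_block_sum (R : zmodType) n k l (a : 'I_n -> R) :
  \sum_(i < n * k | (i < l)%N) a (mxtens_unindex i).1 =
  \sum_(m < k) \sum_(j < n | (j < (l + (k.-1 - m)) %/ k)%N) a j.
Proof.
rewrite mxtens_big (exchange_big_dep xpredT) //; apply: eq_bigr => m _.
apply: eq_big => [j|j _]; last by rewrite mxtens_indexK.
rewrite leq_divRL; last exact: leq_ltn_trans (ltn_ord m).
by have := ltn_ord m; rewrite mulSn; case: k m => // k m mk /=; move: mk; set u := (nat_of_ord j * k.+1)%N; lia.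
Qed.

Lemma initial_block_sum_lt (R : realDomainType) n k (a b : 'I_n -> R) :
  (2 <= n)%N ->
  (forall l, (0 < l < n)%N ->
     \sum_(i < n | (i < l)%N) a i < \sum_(i < n | (i < l)%N) b i) ->
  \sum_i a i = \sum_i b i ->
  forall l, (0 < l < n * k)%N ->
  \sum_(i < n * k | (i < l)%N) a (mxtens_unindex i).1 <
  \sum_(i < n * k | (i < l)%N) b (mxtens_unindex i).1.
Proof.
move=> n2 ab abn l /andP[l0 lnk].
have k0 : (0 < k)%N by case: k lnk => //; rewrite muln0.
have le_ab m : \sum_(i < n | (i < m)%N) a i <= \sum_(i < n | (i < m)%N) b i.
  have [->|m0] := posnP m; first by rewrite !big_pred0_eq.
  have [mn|nm] := ltnP m n; first by rewrite ltW // ab // m0.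
  have full (i : 'I_n) : (i < m)%N = true by rewrite (leq_trans (ltn_ord i)).
  by rewrite (eq_bigl xpredT) // [leRHS](eq_bigl xpredT) // abn.
pose c (m : 'I_k) := ((l + (k.-1 - m)) %/ k)%N.
suff [m cm] : exists m : 'I_k, (0 < c m < n)%N.
  rewrite !initial_block_sum (bigD1 m) //= [ltRHS](bigD1 m) //=.
  by apply: ltr_leD; [exact: ab | exact: ler_sum].
(* If 0 < l < k, residue 0 has a segment of length 1 < n; otherwise residue l mod k has one of
   length l / k, which lies strictly between 0 and n. *)
have [q0|q0] := posnP (l %/ k).
  exists (Ordinal k0); rewrite /c /= subn0.
  have lk : (l < k)%N by rewrite (divn_eq l k) q0 ltn_pmod.
  have -> : (l + k.-1 = k + l.-1)%N by lia.
  rewrite divnDl ?dvdnn // divnn k0 divn_small ?addn0 //.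
  by rewrite prednK // ltnW.
exists (Ordinal (ltn_pmod l k0)); rewrite /c /=.
have -> : ((l + (k.-1 - l %% k)) %/ k = l %/ k)%N.
  have lk := ltn_pmod l k0.
  rewrite {1}(divn_eq l k) -addnA subnKC; last by rewrite -ltnS prednK.
  by rewrite divnMDl // (@divn_small k.-1) ?addn0 // ltn_predL.
by rewrite q0 ltn_divLR.
Qed.

Lemma pos_lower_bound (R : realDomainType) (T : finType) (f : T -> R) :
  (forall t, 0 < f t) -> exists2 d, 0 < d & forall t, d <= f t.
Proof.
move=> f0; exists (\big[Num.min/1]_t f t); last by move=> t; exact: bigmin_le_cond.
by apply: lt_bigmin => //; exact: ltr01.
Qed.

Definition kron_row (R : realType) n k (a : 'rV[R]_n) (c : 'rV[R]_k) : 'rV[R]_(n * k) :=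
  \row_i (a 0 (mxtens_unindex i).1 * c 0 (mxtens_unindex i).2).

Lemma kron_row_sum (R : realType) n k (a : 'rV[R]_n) (c : 'rV[R]_k) :
  \sum_i kron_row a c 0 i = (\sum_i a 0 i) * \sum_j c 0 j.
Proof. by rewrite mulr_sum; apply: eq_bigr => i _; rewrite mxE. Qed.

(** For 0 < l < n k the gap between the partial sums is divided by k, while replacing the uniform
    vector by [c] costs at most d k; hence d is at most gap / k^2. Arbitrary sets [A] avoid having
    to sort [kron_row a c]. *)
Lemma kron_near_uniform (R : realType) n k (a b : 'rV[R]_n) :
  (2 <= n)%N -> (0 < k)%N -> (forall i, 0 <= a 0 i) ->
  (forall i j : 'I_n, (i <= j)%N -> a 0 j <= a 0 i) ->
  (forall l, (0 < l < n)%N ->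
     \sum_(i < n | (i < l)%N) a 0 i < \sum_(i < n | (i < l)%N) b 0 i) ->
  \sum_i a 0 i = 1 -> \sum_i b 0 i = 1 ->
  exists2 d, 0 < d & forall c : 'rV[R]_k, \sum_j c 0 j = 1 ->
    (forall j, `|c 0 j - k%:R^-1| < d) ->
    forall A : {set 'I_(n * k)}, \sum_(i in A) kron_row a c 0 i <=
      \sum_(i < n * k | (i < #|A|)%N) kron_row b (const_mx k%:R^-1) 0 i.
Proof.
move=> n2 k0 a0 asorted ab a1 b1.
have kR : 0 < k%:R :> R by rewrite ltr0n.
pose init (x : 'rV[R]_n) l := \sum_(i < n * k | (i < l)%N) x 0 (mxtens_unindex i).1.
have gap l : (0 < l < n * k)%N -> 0 < init b l - init a l.
  by move=> ?; rewrite subr_gt0 initial_block_sum_lt // a1.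
(* At l = 0 there is no gap; the value 1 keeps the minimum positive. *)
pose g (l : 'I_(n * k)) := if (0 < l)%N then (init b l - init a l) / k%:R ^+ 2 else 1.
have [|d d0 dg] := @pos_lower_bound R _ g.
  by move=> l; rewrite /g; case: ifP => // l0; rewrite divr_gt0 ?exprn_gt0 // gap // l0 /=.
exists d => // c c1 cd A.
(* For the full set there is no slack either, but both sums equal 1. *)
have [|AT] := eqVneq A [set: _].
  move=> ->; rewrite (eq_bigl xpredT); last by move=> i; rewrite inE.
  rewrite kron_row_sum a1 c1 mulr1 (eq_bigl xpredT); last first.
    by move=> i; rewrite cardsT card_ord ltn_ord.
  rewrite kron_row_sum b1 mul1r (eq_bigr (fun=> k%:R^-1)); last by move=> i _; rewrite mxE.
  by rewrite sumr_const card_ord -[X in _ <= X]mulr_natr mulVf ?gt_eqF.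
have [A0|A0] := posnP #|A|.
  by move/eqP: A0; rewrite cards_eq0 => /eqP ->; rewrite big_set0 big_pred0 // => i; rewrite cards0.
have AN : (#|A| < n * k)%N.
  rewrite -[X in (_ < X)%N]card_ord -cardsT; apply: proper_card.
  by rewrite finset.properEneq AT finset.subsetT.
have := dg (Ordinal AN); rewrite /g A0 /= ler_pdivlMr ?exprn_gt0 // => dle.
have -> : \sum_(i < n * k | (i < #|A|)%N) kron_row b (const_mx k%:R^-1) 0 i = init b #|A| / k%:R.
  by rewrite mulr_suml; apply: eq_bigr => i _; rewrite !mxE.
(* Split [c] into its uniform part and its deviation. *)
have -> : \sum_(i in A) kron_row a c 0 i = \sum_(i in A) a 0 (mxtens_unindex i).1 / k%:R +
   \sum_(i in A) a 0 (mxtens_unindex i).1 * (c 0 (mxtens_unindex i).2 - k%:R^-1).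
  by rewrite -big_split; apply: eq_bigr => i _; rewrite mxE /=; ring.
apply: (@le_trans _ _ (init a #|A| / k%:R + d * k%:R)).
  apply: lerD.
    rewrite -mulr_suml ler_pM2r ?invr_gt0 //.
    apply: (sum_le_initial (f := fun i => a 0 (mxtens_unindex i).1)) => i j ij.
    by apply: asorted; rewrite /= leq_div2r.
  apply: (@le_trans _ _ (\sum_(i < n * k) a 0 (mxtens_unindex i).1 * d)).
    rewrite [leLHS]big_mkcond; apply: ler_sum => i _; case: ifP => _.
      by rewrite ler_wpM2l // (le_trans (ler_norm _)) // ltW.
    by rewrite mulr_ge0 // ltW.
  rewrite -mulr_suml mxtens_big (eq_bigr (fun j => a 0 j * k%:R)); last first.
    move=> j _; transitivity (\sum_(m < k) a 0 j).
      by apply: eq_bigr => m _; rewrite mxtens_indexK.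
    by rewrite sumr_const card_ord mulr_natr.
  by rewrite -mulr_suml a1 mul1r mulrC.
rewrite -lerBrDl -mulrBl ler_pdivlMr // (le_trans _ dle) //.
by rewrite expr2 mulrA.
Qed.

(** * Schmidt vectors of states and of the maximally entangled state *)

Lemma schmidt_coefP (R : realType) n (M : 'M[R[i]]_n) : is_schmidt M (schmidt_coef M).
Proof. by have [a aP] := is_schmidt_exists M; exact: (xgetPex 0 (ex_intro _ a aP)). Qed.

(** Schmidt vectors are already nonincreasing, so this removes the rearrangements from [esum] and
    [state_dist]. *)
Lemma rearr_sorted (R : realType) N (x : 'rV[R]_N) :
  (forall i j : 'I_N, (i <= j)%N -> x 0 j <= x 0 i) -> rearr x = x.
Proof.
move=> xsorted; have le_trans : transitive (>=%R : rel R).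
  by move=> y z w /[swap]; exact: le_trans.
apply/rowP => i; rewrite mxE sorted_sort //.
  by rewrite (nth_map i) ?size_enum_ord // nth_ord_enum.
apply: (@homo_sorted _ _ _ (relpre val leq)); first by move=> j k; exact: xsorted.
by rewrite -sorted_map val_enum_ord iota_sorted.
Qed.

Lemma sqrt_mx_gram (R : realType) n (a : 'rV[R]_n) :
  (forall i, 0 <= a 0 i) ->
  sqrt_mx a *m adjointmx (sqrt_mx a) = diag_mx (map_mx (real_complex R) a).
Proof.
move=> a0; rewrite /sqrt_mx /adjointmx tr_diag_mx map_diag_mx mulmx_diag.
congr diag_mx; apply/rowP => i; rewrite !mxE.
transitivity ((Num.sqrt (a 0 i))%:C * (Num.sqrt (a 0 i))%:C : R[i]).
  by congr (_ * _); exact: conjCr.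
by rewrite -rmorphM /= -expr2 sqr_sqrtr.
Qed.

(** The factor [V] cancels in M M^*, which is therefore diagonalized by [U] with eigenvalues [a]. *)
Lemma schmidt_gram (R : realType) n (a : 'rV[R]_n) (M U V : 'M[R[i]]_n) :
  (forall i, 0 <= a 0 i) ->
  adjointmx U *m U = 1%:M -> adjointmx V *m V = 1%:M ->
  M = U *m sqrt_mx a *m V^T ->
  adjointmx U *m (M *m adjointmx M) *m U = diag_mx (map_mx (real_complex R) a).
Proof.
move=> a0 UU VV ->.
have VV' : V^T *m adjointmx V^T = 1%:M.
  rewrite -(trmx1 _ n) -VV trmx_mul; congr (_ *m _).
  by rewrite /adjointmx map_trmx trmxK.
rewrite !adjointmxM !mulmxA UU mul1mx -(mulmxA _ V^T) VV' mulmx1.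
by rewrite -!mulmxA UU mulmx1 sqrt_mx_gram.
Qed.

Lemma is_schmidt_sum (R : realType) n (M : 'M[R[i]]_n) a :
  is_state M -> is_schmidt M a -> \sum_i a 0 i = 1.
Proof.
move=> M1 [a0 _ [U [V [UU VV]]]]; rewrite schmidt_sumE => ME.
have /(congr1 mxtrace) := schmidt_gram a0 UU VV ME.
have UU' : U *m adjointmx U = 1%:M by exact: mulmx1C.
rewrite -mulmxA mxtrace_mulC -(mulmxA _ U) UU' mulmx1 mxtrace_diag.
have -> : \tr (M *m adjointmx M) = 1.
  by rewrite -M1; apply: eq_bigr => i _; rewrite mulmx_adj_diag.
under eq_bigr do rewrite mxE.
by rewrite -rmorph_sum => -[<-].
Qed.

Lemma max_entangledE (R : realType) k :
  max_entangled R k = sqrt_mx (const_mx k%:R^-1).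
Proof.
apply/matrixP => i j; rewrite summxE !mxE (bigD1 i) //= big1 ?addr0; last first.
  by move=> m mi; rewrite !mxE [i == m]eq_sym (negbTE mi) mulr0.
by rewrite !mxE eqxx /= mul1r sqrtrV // mulr_natr eq_sym.
Qed.

(** The Gram matrix is the scalar 1/k, unchanged by unitary conjugation, so every Schmidt vector, in
    particular the chosen one, is constant. *)
Lemma schmidt_coef_max_entangled (R : realType) k :
  schmidt_coef (max_entangled R k) = const_mx k%:R^-1.
Proof.
have [] := schmidt_coefP (max_entangled R k); set c := schmidt_coef _.
move=> c0 _ [U [V [UU VV]]]; rewrite schmidt_sumE => ME.
have := schmidt_gram c0 UU VV ME; rewrite max_entangledE.
have -> : sqrt_mx (const_mx k%:R^-1) *m adjointmx (sqrt_mx (const_mx k%:R^-1)) = (k%:R^-1)%:C%:M :> 'M[R[i]]_k.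
  rewrite sqrt_mx_gram; last by move=> i; rewrite mxE invr_ge0.
  by apply/matrixP => i j; rewrite !mxE.
rewrite mul_mx_scalar -scalemxAl UU => E.
apply/rowP => j; have /matrixP/(_ j j) := E.
by rewrite !mxE eqxx mulr1 mulr1n => -[].
Qed.

(** * Schmidt forms of tensor products and local unitaries *)

Lemma sqrt_mx_tens (R : realType) n k (a : 'rV[R]_n) (c : 'rV[R]_k) :
  (forall i, 0 <= a 0 i) -> sqrt_mx a *t sqrt_mx c = sqrt_mx (kron_row a c).
Proof.
move=> a0; apply/matrixP => i j.
case: (mxtens_indexP i) => i1 i2; case: (mxtens_indexP j) => j1 j2.
rewrite tensmxE !mxE !mxtens_indexK /= (inj_eq (can_inj (@mxtens_indexK n k))) xpair_eqE.
case: eqP => _ /=; last by rewrite mul0r.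
case: eqP => _ /=; last by rewrite mulr0.
by rewrite !mulr1n sqrtrM // rmorphM.
Qed.

Lemma adjointmx_tens (R : realType) m n p q (A : 'M[R[i]]_(m, n)) (B : 'M[R[i]]_(p, q)) :
  adjointmx (A *t B) = adjointmx A *t adjointmx B.
Proof. by rewrite /adjointmx trmx_tens map_mxT. Qed.

Lemma tens_isometry (R : realType) n k (U : 'M[R[i]]_n) (V : 'M[R[i]]_k) :
  adjointmx U *m U = 1%:M -> adjointmx V *m V = 1%:M ->
  adjointmx (U *t V) *m (U *t V) = 1%:M.
Proof.
move=> UU VV; rewrite adjointmx_tens tensmx_mul UU VV; apply/matrixP => i j.
case: (mxtens_indexP i) => i1 i2; case: (mxtens_indexP j) => j1 j2.
rewrite tensmxE !mxE (inj_eq (can_inj (@mxtens_indexK n k))) xpair_eqE.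
by rewrite -natrM mulnb.
Qed.

Lemma schmidt_tens (R : realType) n k (M : 'M[R[i]]_n) (N : 'M[R[i]]_k) a c :
  is_schmidt M a -> is_schmidt N c ->
  exists U V, [/\ adjointmx U *m U = 1%:M, adjointmx V *m V = 1%:M &
    M *t N = U *m sqrt_mx (kron_row a c) *m V^T].
Proof.
move=> [a0 _ [U [V [UU VV]]]]; rewrite schmidt_sumE => ->.
move=> [c0 _ [U' [V' [UU' VV']]]]; rewrite schmidt_sumE => ->.
exists (U *t U'), (V *t V'); split; try exact: tens_isometry.
by rewrite -sqrt_mx_tens // trmx_tens !tensmx_mul.
Qed.

Lemma locc_to_schmidt (R : realType) p q (phi : 'M[R[i]]_(p, q)) n
    (U V D : 'M[R[i]]_n) :
  adjointmx U *m U = 1%:M -> adjointmx V *m V = 1%:M ->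
  locc phi D -> locc phi (U *m D *m V^T).
Proof.
move=> UU VV phiD; apply: (@locc_Alice_isometry _ _ _ _ _ _ _ (adjointmx U)).
  by rewrite adjointmxK; exact: mulmx1C.
apply: (@locc_Bob_isometry _ _ _ _ _ _ _ (adjointmx V)).
  by rewrite adjointmxK; exact: mulmx1C.
have VV' : V^T *m (adjointmx V)^T = 1%:M by rewrite -trmx_mul VV trmx1.
by rewrite !mulmxA UU mul1mx -mulmxA VV' mulmx1.
Qed.

Lemma locc_of_schmidt (R : realType) p q (phi : 'M[R[i]]_(p, q)) n
    (U V D : 'M[R[i]]_n) :
  adjointmx U *m U = 1%:M -> adjointmx V *m V = 1%:M ->
  locc phi (U *m D *m V^T) -> locc phi D.
Proof.
move=> UU VV phiD; apply: (locc_Alice_isometry UU).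
by apply: (locc_Bob_isometry VV).
Qed.

(** * Ordered coefficients, the distance of states and the conclusion *)

Lemma esum_sorted (R : realType) N l (x : 'rV[R]_N) :
  (forall i j : 'I_N, (i <= j)%N -> x 0 j <= x 0 i) ->
  esum l x = \sum_(i < N | (i < l)%N) x 0 i.
Proof. by move=> xs; rewrite /esum rearr_sorted. Qed.

Lemma state_dist_coord (R : realType) k (chi xi : 'M[R[i]]_k) d j :
  state_dist chi xi < d ->
  `|schmidt_coef chi 0 j - schmidt_coef xi 0 j| < d.
Proof.
have [_ chis _] := schmidt_coefP chi; have [_ xis _] := schmidt_coefP xi.
rewrite /state_dist !rearr_sorted //; apply: le_lt_trans.
rewrite -sqrtr_sqr; apply: ler_wsqrtr; rewrite (bigD1 j) //= lerDl.
by rewrite sumr_ge0 // => i _; rewrite sqr_ge0.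
Qed.

Theorem theorem6p1 (R : realType) (n k : nat) (phi psi : 'M[R[i]]_n) :
  (2 <= n)%N -> (1 <= k)%N ->
  is_state phi -> So phi psi ->
  exists2 delta : R, 0 < delta &
    forall chi : 'M[R[i]]_k, is_state chi ->
      state_dist chi (max_entangled R k) < delta ->
      locc_transformable (psi *t chi) (phi *t max_entangled R k).
Proof.
move=> n2 k0 phi1 [psi1 [ab _]].
have aP := schmidt_coefP psi; have bP := schmidt_coefP phi.
set a := schmidt_coef psi in aP ab; set b := schmidt_coef phi in bP ab.
have [[a0 asorted _] [b0 bsorted _]] := (aP, bP).
have [//|d d0 dP] := kron_near_uniform n2 k0 a0 asorted _ (is_schmidt_sum psi1 aP) (is_schmidt_sum phi1 bP).
  by move=> l /ab; rewrite !esum_sorted.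
exists d => // chi chi1 chid; rewrite /locc_transformable.
have cP := schmidt_coefP chi; set c := schmidt_coef chi in cP.
have [c0 _ _] := cP; have c1 := is_schmidt_sum chi1 cP.
have uP := schmidt_coefP (max_entangled R k); rewrite schmidt_coef_max_entangled in uP.
pose x := kron_row a c; pose y := kron_row b (const_mx k%:R^-1 : 'rV[R]_k).
have maj (A : {set 'I_(n * k)}) : \sum_(i in A) x 0 i <= \sum_(i < n * k | (i < #|A|)%N) y 0 i.
  by apply: dP => // j; have := state_dist_coord j chid; rewrite schmidt_coef_max_entangled mxE.
have [U [V [UU VV ->]]] := schmidt_tens aP cP; rewrite -/x.
apply: locc_to_schmidt => //.
have [s xs] := sorting_perm (fun i => x 0 i).
pose x' := \row_i x 0 (s i).
have x'E i : x' 0 i = x 0 (s i) by rewrite [LHS]mxE.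
have x0 i : 0 <= x 0 i by rewrite mxE mulr_ge0.
(* A mixture with a single permutation relabels the basis, replacing [x] by its sorted version [x']
   as [locc_majorized] demands. *)
apply: (@locc_mix _ _ _ _ _ 1 (fun=> 1) (fun=> (s^-1)%g) _ x').
- by [].
- by rewrite big_ord1.
- by move=> i; rewrite x'E.
- by move=> i; rewrite big_ord1 mul1r x'E permKV.
have y1 : \sum_i y 0 i = 1.
  rewrite kron_row_sum (is_schmidt_sum phi1 bP) mul1r.
  under eq_bigr do rewrite mxE.
  by rewrite sumr_const card_ord -[LHS]mulr_natr mulVf // pnatr_eq0 -lt0n.
apply: (@locc_majorized _ _ _ _ _ _ y).
- by move=> i; rewrite !mxE mulr_ge0 ?invr_ge0.
- by move=> i j /xs; rewrite !x'E.
(* The first l entries of [x'] are the entries of [x] on the image under [s] of the initial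
   segment. *)
- move=> l; have := maj (s @: [set i : 'I_(n * k) | (i < l)%N]).
  rewrite card_imset ?card_ltn_ord; last exact: perm_inj.
  rewrite big_imset /=; last by move=> i j _ _; exact: perm_inj.
  rewrite (eq_bigl (fun i : 'I__ => (i < l)%N)); last by move=> i; rewrite inE.
  rewrite [leRHS](eq_bigl (fun i : 'I__ => (i < l)%N)); last first.
    by move=> i; rewrite leq_min ltn_ord andbT.
  by rewrite (eq_bigr (fun i => x' 0 i)) // => i _; rewrite x'E.
- have <- : \sum_i x 0 i = \sum_i y 0 i.
    by rewrite y1 kron_row_sum c1 (is_schmidt_sum psi1 aP) mulr1.
  rewrite [RHS](reindex_inj (@perm_inj _ s)).
  by apply: eq_bigr => i _; rewrite x'E.
(* Local unitaries turn the diagonal vector into the target itself, reached with multiple 1. *)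
have [U' [V' [UU' VV' ME]]] := schmidt_tens bP uP.
apply: (locc_of_schmidt UU' VV'); rewrite -ME -[X in locc _ X]scale1r.
exact: locc_stop.
Qed.
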